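(* (Array Modelling.) Work in a monster model of a positive theory with the Joint Continuation Property. Let $(a_{ij})_{i,j<\omega}$ be an array of compatible tuples and $E$ a (small) set of parameters. Then there is an array $(b_{ij})_{i,j<\omega}$ which is strongly indiscernible over $E$ and $\mathrm{EM}_{\mathrm{ar}}$-based on $(a_{ij})_{i,j<\omega}$ over $E$.
   Context: Positive logic: positive formulas are those built from atomic formulas with $\wedge,\vee,\exists$; a positive (h-inductive) theory $T$ is a set of sentences $\forall x(\phi\to\psi)$ with $\phi,\psi$ positive. A model $M$ of $T$ is positively existentially closed (pec) if every homomorphism from $M$ to a model of $T$ reflects positive formulas. $T$ has the Joint Continuation Property (JCP) if any two models admit homomorphisms to a common model. A monster model $\mathfrak U$ is a sufficiently saturated (for positive formulas) and strongly homogeneous pec model. ''Formula'' means positive formula and ''type'' means positive type; $\operatorname{tp}(a/E)$ is the set of positive formulas over $E$ satisfied by $a$. Tuples may be infinite (small). Tuples are compatible if they belong to the same cartesian product of sorts. $T$ is not assumed thick. $\mathfrak L_{\mathrm{ar}}=\{<_1,<_2\}$, interpreted on $\omega\times\omega$ by: $(i,j)<_1(i',j')$ iff $i<i'$; $(i,j)<_2(i',j')$ iff $i=i'$ and $j<j'$. For a language $\mathfrak L$ and an $\mathfrak L$-structure $I$ indexing tuples $(a_i)_{i\in I}$, the type $\mathrm{EM}_{\mathfrak L}((a_i)_{i\in I}/E)$ is the set of formulas $\phi(x_{\bar\eta})$ over $E$, with $\bar\eta$ a finite tuple in $I$, such that $\models\phi(a_{\bar\xi})$ for every tuple $\bar\xi$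 from $I$ with the same quantifier-free $\mathfrak L$-type as $\bar\eta$. The family $(a_i)_{i\in I}$ is $\mathfrak L$-indiscernible over $E$ if $\mathrm{EM}_{\mathfrak L}((a_i)_{i\in I}/E)=\operatorname{tp}((a_i)_{i\in I}/E)$. A family $(b_j)_{j\in J}$ indexed by an $\mathfrak L$-structure $J$ is $\mathrm{EM}_{\mathfrak L}$-based on $(a_i)_{i\in I}$ over $E$ if for all $\phi(x_{\bar\eta})\in\mathrm{EM}_{\mathfrak L}((a_i)_{i\in I}/E)$ and all tuples $\bar\xi$ from $J$ with the same quantifier-free $\mathfrak L$-type as $\bar\eta$, one has $\models\phi(b_{\bar\xi})$. $\mathrm{EM}_{\mathrm{ar}}$ means $\mathrm{EM}_{\mathfrak L_{\mathrm{ar}}}$. ''Strongly indiscernible'' means $\mathfrak L_{\mathrm{ar}}$-indiscernible. *)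

(* Defs.v *)
From Stdlib Require List.
From mathcomp Require Import all_boot.

Set Implicit Arguments.
Unset Strict Implicit.
Unset Printing Implicit Defensive.

(** Many-sorted languages with sorts [S]; one-sorted languages are [language unit]. *)
Record language (S : Type) := Language {
  fsym : Type;
  farity : fsym -> nat;
  fdom : forall f : fsym, 'I_(farity f) -> S;
  fcod : fsym -> S;
  rsym : Type;
  rarity : rsym -> nat;
  rdom : forall r : rsym, 'I_(rarity r) -> S
}.

Record structure (S : Type) (L : language S) := Structure {
  carrier :> S -> Type;
  fun_interp : forall f : fsym L,
    (forall i : 'I_(farity f), carrier (fdom i)) -> carrier (fcod f);
  rel_interp : forall r : rsym L,
    (forall i : 'I_(rarity r), carrier (rdom i)) -> Prop
}.

(** A family of variables is a type [V] with a sort assignment [vs : V -> S];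
    it may be infinite, although each formula only mentions finitely many
    variables. *)
Definition stuple S (L : language S) (M : structure L) V (vs : V -> S) :=
  forall v : V, M (vs v).

Inductive term S (L : language S) (V : Type) (vs : V -> S) : S -> Type :=
| Var (v : V) : term L vs (vs v)
| App (f : fsym L) (t : forall i : 'I_(farity f), term L vs (fdom i)) :
    term L vs (fcod f).

Inductive atomic S (L : language S) (V : Type) (vs : V -> S) : Type :=
| AEq (s : S) (t u : term L vs s)
| ARel (r : rsym L) (t : forall i : 'I_(rarity r), term L vs (rdom i)).

Fixpoint eval S (L : language S) (M : structure L) V (vs : V -> S)
    (e : stuple M vs) s (t : term L vs s) : M s :=
  match t in term _ _ s' return M s' with
  | Var v => e v
  | App f ts => fun_interp (fun i => eval e (ts i))
  end.

Definition sat_atomic S (L : language S) (M : structure L) V (vs : V -> S)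
    (e : stuple M vs) (A : atomic L vs) : Prop :=
  match A with
  | AEq _ t u => eval e t = eval e u
  | ARel r ts => rel_interp (fun i => eval e (ts i))
  end.

Definition ext_sort S V (vs : V -> S) (s : S) (o : option V) : S :=
  if o is Some v then vs v else s.

Definition ext_tuple S (L : language S) (M : structure L) V (vs : V -> S)
    (e : stuple M vs) s (m : M s) : stuple M (ext_sort vs s) :=
  fun o => match o return M (ext_sort vs s o) with
           | Some v => e v
           | None => m
           end.

(** Positive formulas. As usual in positive logic, truth and falsity are
    allowed, so that h-inductive sentences can express inconsistency.
    [Ex s phi] binds the variable [None] of [phi], of sort [s]. *)
Inductive formula S (L : language S) (V : Type) (vs : V -> S) : Type :=
| Atom (A : atomic L vs)
| Top
| Bot
| And (phi psi : formula L vs)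
| Or (phi psi : formula L vs)
| Ex (s : S) (phi : formula L (ext_sort vs s)).

Fixpoint sat S (L : language S) (M : structure L) V (vs : V -> S)
    (phi : formula L vs) : stuple M vs -> Prop :=
  match phi with
  | Atom A => fun e => sat_atomic e A
  | Top => fun _ => True
  | Bot => fun _ => False
  | And f g => fun e => sat f e /\ sat g e
  | Or f g => fun e => sat f e \/ sat g e
  | Ex s f => fun e => exists m : M s, sat f (ext_tuple e m)
  end.

Inductive qf_formula S (L : language S) (V : Type) (vs : V -> S) : Type :=
| QAtom (A : atomic L vs)
| QNot (phi : qf_formula L vs)
| QAnd (phi psi : qf_formula L vs)
| QOr (phi psi : qf_formula L vs).

Fixpoint qf_sat S (L : language S) (M : structure L) V (vs : V -> S)
    (e : stuple M vs) (phi : qf_formula L vs) : Prop :=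
  match phi with
  | QAtom A => sat_atomic e A
  | QNot f => ~ qf_sat e f
  | QAnd f g => qf_sat e f /\ qf_sat e g
  | QOr f g => qf_sat e f \/ qf_sat e g
  end.

(** The sentence [forall x, hyp x -> concl x], with [x] a finite tuple. *)
Record h_inductive S (L : language S) := HInductive {
  nvars : nat;
  vsort : 'I_nvars -> S;
  hyp : formula L vsort;
  concl : formula L vsort
}.

Definition theory S (L : language S) := h_inductive L -> Prop.

Definition is_model S (L : language S) (T : theory L) (M : structure L) : Prop :=
  forall c, T c -> forall e : stuple M (@vsort _ _ c),
    sat (hyp c) e -> sat (concl c) e.

Definition is_hom S (L : language S) (M N : structure L)
    (h : forall s, M s -> N s) : Prop :=
  (forall (f : fsym L) (m : forall i : 'I_(farity f), M (fdom i)),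
     h _ (fun_interp m) = fun_interp (fun i => h _ (m i))) /\
  (forall (r : rsym L) (m : forall i : 'I_(rarity r), M (rdom i)),
     rel_interp m -> rel_interp (fun i => h _ (m i))).

Definition is_aut S (L : language S) (M : structure L)
    (h : forall s, M s -> M s) : Prop :=
  is_hom h /\
  exists g : forall s, M s -> M s,
    is_hom g /\ forall s, cancel (h s) (g s) /\ cancel (g s) (h s).

Definition reflects S (L : language S) (M N : structure L)
    (h : forall s, M s -> N s) : Prop :=
  forall n (vs : 'I_n -> S) (phi : formula L vs) (e : stuple M vs),
    sat phi (fun v => h _ (e v) : N _) -> sat phi e.

Definition is_pec S (L : language S) (T : theory L) (M : structure L) : Prop :=
  is_model T M /\
  forall (N : structure L) (h : forall s, M s -> N s),
    is_model T N -> is_hom h -> reflects h.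

Definition JCP S (L : language S) (T : theory L) : Prop :=
  forall M1 M2 : structure L, is_model T M1 -> is_model T M2 ->
  exists (N : structure L) (h1 : forall s, M1 s -> N s)
         (h2 : forall s, M2 s -> N s),
    [/\ is_model T N, is_hom h1 & is_hom h2].

(** [|A| < |K|]. *)
Definition card_lt (A K : Type) : Prop :=
  (exists f : A -> K, injective f) /\ ~ (exists g : K -> A, injective g).

(** Sets of parameters and formulas over them. A formula over [E] in the
    variables [V] is a formula whose variables are those of [V] together with
    one name for each element of [E]. *)
Definition pset S (L : language S) (M : structure L) := {s : S & M s} -> Prop.

Definition elt S (L : language S) (M : structure L) (E : pset M) :=
  {p : {s : S & M s} | E p}.

Definition over_sort S (L : language S) (M : structure L) (E : pset M)
    V (vs : V -> S) (w : V + elt E) : S :=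
  match w with inl v => vs v | inr p => projT1 (proj1_sig p) end.

Definition over_tuple S (L : language S) (M : structure L) (E : pset M)
    V (vs : V -> S) (e : stuple M vs) : stuple M (over_sort (E := E) vs) :=
  fun w => match w return M (over_sort vs w) with
           | inl v => e v
           | inr p => projT2 (proj1_sig p)
           end.

Definition formula_over S (L : language S) (M : structure L) (E : pset M)
    V (vs : V -> S) := formula L (over_sort (E := E) vs).

Definition sat_over S (L : language S) (M : structure L) (E : pset M)
    V (vs : V -> S) (phi : formula_over E vs) (e : stuple M vs) : Prop :=
  sat phi (over_tuple e).

(** [|K|]-saturation for positive formulas, in fewer than [|K|] variables. *)
Definition saturated S (L : language S) (K : Type) (M : structure L) : Prop :=
  forall (E : pset M) (V : Type) (vs : V -> S)
         (Sigma : formula_over E vs -> Prop),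
    card_lt (elt E) K -> card_lt V K ->
    (forall l : seq (formula_over E vs),
       (forall phi, List.In phi l -> Sigma phi) ->
       exists e : stuple M vs, forall phi, List.In phi l -> sat_over phi e) ->
    exists e : stuple M vs, forall phi, Sigma phi -> sat_over phi e.

Definition strongly_homogeneous S (L : language S) (K : Type)
    (M : structure L) : Prop :=
  forall (V : Type) (vs : V -> S) (a b : stuple M vs),
    card_lt V K ->
    (forall phi : formula L vs, sat phi a <-> sat phi b) ->
    exists h : forall s, M s -> M s, is_aut h /\ forall v, h _ (a v) = b v.

(** The cardinal [|K|] is the degree of saturation, larger than [|L| + aleph_0];
    "small" means of cardinality less than [|K|]. *)
Record is_monster S (L : language S) (T : theory L) (K : Type)
    (U : structure L) : Prop := IsMonster {
  monster_nat : card_lt nat K;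
  monster_sort : card_lt S K;
  monster_func : card_lt (fsym L) K;
  monster_rel : card_lt (rsym L) K;
  monster_pec : is_pec T U;
  monster_saturated : saturated K U;
  monster_homogeneous : strongly_homogeneous K U
}.

(** Equality of the quantifier-free types of [eta] in [I] and [xi] in [J]. *)
Definition same_qftp (Li : language unit) (I J : structure Li) n
    (eta : 'I_n -> I tt) (xi : 'I_n -> J tt) : Prop :=
  forall phi : qf_formula Li (fun _ : 'I_n => tt),
    qf_sat (eta : stuple I (fun _ => tt)) phi <->
    qf_sat (xi : stuple J (fun _ => tt)) phi.

(** Families of compatible tuples, all of sorts [xs : X -> S]. A formula
    [phi(x_eta)], with [eta = (eta_0, ..., eta_(n-1))] a finite tuple of indices,
    is given by [eta] and by a formula [phi] in the variables ['I_n * X], where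
    [(k, x)] stands for the coordinate [x] of the tuple of index [eta_k]. *)
Definition block_sort S X (xs : X -> S) n (w : 'I_n * X) : S := xs w.2.

Definition block S (L : language S) (M : structure L) X (xs : X -> S)
    (I : Type) (a : I -> stuple M xs) n (eta : 'I_n -> I) :
    stuple M (@block_sort _ _ xs n) :=
  fun w => a (eta w.1) w.2.

Definition tp_over S (L : language S) (M : structure L) (E : pset M)
    X (xs : X -> S) (I : Type) (a : I -> stuple M xs)
    n (eta : 'I_n -> I) (phi : formula_over E (@block_sort _ _ xs n)) : Prop :=
  sat_over phi (block a eta).

Definition EM S (L : language S) (M : structure L) (E : pset M)
    (Li : language unit) (I : structure Li) X (xs : X -> S)
    (a : I tt -> stuple M xs)
    n (eta : 'I_n -> I tt) (phi : formula_over E (@block_sort _ _ xs n)) : Prop :=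
  forall xi : 'I_n -> I tt, same_qftp eta xi -> sat_over phi (block a xi).

Definition indiscernible S (L : language S) (M : structure L) (E : pset M)
    (Li : language unit) (I : structure Li) X (xs : X -> S)
    (a : I tt -> stuple M xs) : Prop :=
  forall n (eta : 'I_n -> I tt) (phi : formula_over E (@block_sort _ _ xs n)),
    EM a eta phi <-> tp_over a eta phi.

Definition EM_based S (L : language S) (M : structure L) (E : pset M)
    (Li : language unit) (I J : structure Li) X (xs : X -> S)
    (b : J tt -> stuple M xs) (a : I tt -> stuple M xs) : Prop :=
  forall n (eta : 'I_n -> I tt) (phi : formula_over E (@block_sort _ _ xs n)),
    EM a eta phi ->
    forall xi : 'I_n -> J tt, same_qftp eta xi -> sat_over phi (block b xi).

Inductive ar_rel := Lt1 | Lt2.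

Definition L_ar : language unit :=
  @Language unit Empty_set (fun _ => 0) (fun _ _ => tt) (fun _ => tt)
    ar_rel (fun _ => 2) (fun _ _ => tt).

Definition omega2 : structure L_ar :=
  @Structure unit L_ar (fun _ => (nat * nat)%type)
    (fun f => match f with end)
    (fun r p =>
       let p0 : nat * nat := p ord0 in
       let p1 : nat * nat := p ord_max in
       match r with
       | Lt1 => p0.1 < p1.1
       | Lt2 => p0.1 = p1.1 /\ p0.2 < p1.2
       end).

Definition strongly_indiscernible S (L : language S) (M : structure L)
    (E : pset M) X (xs : X -> S) (a : nat * nat -> stuple M xs) : Prop :=
  @indiscernible S L M E L_ar omega2 X xs a.

Definition EM_ar_based S (L : language S) (M : structure L)
    (E : pset M) X (xs : X -> S) (b a : nat * nat -> stuple M xs) : Prop :=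
  @EM_based S L M E L_ar omega2 omega2 X xs b a.

(* Main.v *)
From Stdlib Require List Eqdep.
Require Import Defs.
From mathcomp Require Import all_boot.
From mathcomp Require Import boolp classical_sets functions cardinality wochoice.

Set Implicit Arguments.
Unset Strict Implicit.
Unset Printing Implicit Defensive.

(** Two obstacles shape the proof. Compactness only realises families in fewer
    than [K] variables, whereas the Erdos-Rado theorem needs index sets far
    longer than [K]. And a positive formula has no negation, so realising a set
    of formulas says nothing about the formulas outside that set. The argument
    therefore manipulates finitely satisfiable families of definable properties
    of arrays, over index sets of any size, makes these families maximal, and
    only realises the last one, which concerns countable arrays.

    Consider pairs [(k, P)] where the definable property [P] of arrays depends
    only on the entries in the [k] by [k] initial grid. A family of such pairs is
    [coherent] if it is finitely satisfiable and closed under transport of the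
    grid along order-preserving maps into other grids. The properties shared by
    all copies of a grid inside [a] form a coherent family. Let [G] be a maximal
    coherent family containing it, and let [b] realise [G]. Then [b] satisfies
    the EM-type of [a]. Strong indiscernibility follows from [coherent_maximal]:
    every [P] outside [G] is contradicted by some [R] in [G] on the same grid.
    Indeed, if [P] holds at one copy of the grid in [b], then no such [R] exists,
    because [R] would hold at this copy by coherence; so [P] is in [G], and
    hence holds at all copies. Two tuples with the same quantifier-free type are
    compared by mapping both to the same place ([same_qftp_amalgam]).

    To prove [coherent_maximal], transport [G] to arrays indexed by [W x W], for
    a very long well-order [W], and extend the result to a maximal finitely
    satisfiable family [D], about whose symmetry nothing is known. Colour each
    finite increasing sequence of [W] by the set of properties that [D] asserts
    of the [k]-grid coded by the sequence. By [erdos_rado] there is a copy of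
    [omega x omega] in [W x W] along which the properties that [D] asserts of a
    [k]-grid do not depend on the grid. Adding these properties to [G] keeps it
    coherent, so they were already in [G]. If [P] is not among them, finitely many
    members of [D] contradict it at the [k]-grid; their conjunction, with the
    entries outside the grid existentially quantified, is still definable and is
    still in [D], so it is the required [R]. *)

(** * Well-orders *)

Record well_ordered (W : Type) (lt : W -> W -> Prop) : Prop := WellOrdered {
  wo_irr : forall x, ~ lt x x;
  wo_trans : forall x y z, lt x y -> lt y z -> lt x z;
  wo_total : forall x y, lt x y \/ x = y \/ lt y x;
  wo_least : forall P : W -> Prop, (exists x, P x) ->
    exists x, P x /\ forall y, P y -> ~ lt y x
}.

Lemma well_ordered_wf W (lt : W -> W -> Prop) :
  well_ordered lt -> well_founded lt.
Proof.
move=> wo x; apply: contrapT => nx.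
have [y [ny ymin]] := wo_least wo (ex_intro (fun x => ~ Acc lt x) x nx).
by apply: ny; constructor => z zy; apply: contrapT => /ymin.
Qed.

Lemma exists_well_order (T : Type) : exists lt : T -> T -> Prop, well_ordered lt.
Proof.
have [R woR] := well_ordering_principle {classic T}.
have Rmin (P : T -> Prop) : (exists x, P x) ->
    exists x, P x /\ forall y, P y -> R x y.
  move=> [x Px]; have [|z [[zP zmin] _]] := woR [pred x | `[< P x >]].
    by exists x; apply/asboolP.
  exists z; split; first exact/asboolP.
  by move=> y Py; apply: zmin; apply/asboolP.
have [Ranti Rtot] : antisymmetric R /\ total R.
  split.
    move=> x y /andP[xy yx]; have Rrefl z : R z z.
      by have [_ [-> zz]] := Rmin (eq^~ z) (ex_intro _ z erefl); apply: zz.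
    have [|z [_ zuniq]] := woR [pred z | `[< z = x \/ z = y >]].
      by exists x; apply/asboolP; left.
    transitivity z; [symmetry|]; apply: zuniq; split; try (by apply/asboolP; auto);
      by move=> u /asboolP[->|->].
  move=> x y.
  have [z [[->|->] zmin]] := Rmin (fun z => z = x \/ z = y)
    (ex_intro _ x (or_introl erefl)).
  - by rewrite (zmin y) //; right.
  - by rewrite (zmin x) ?orbT//; left.
have Rtrans x y z : R x y -> R y z -> R x z.
  move=> xy yz.
  have [w [H wmin]] :=
    Rmin (fun w => [\/ w = x, w = y | w = z]) (ex_intro _ x (Or31 _ _ erefl)).
  have wx := wmin x (Or31 _ _ erefl); have wy := wmin y (Or32 _ _ erefl).
  have wz := wmin z (Or33 _ _ erefl).
  case: H wx wy wz => -> // wx wy wz.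
    by have -> : x = y by apply: Ranti; rewrite xy.
  have e : y = z by apply: Ranti; rewrite yz.
  by rewrite -e.
exists (fun x y => R x y /\ x <> y); split.
- by move=> x [].
- move=> x y z [xy nxy] [yz nyz]; split; first exact: Rtrans yz.
  by move=> e; apply: nxy; apply: Ranti; rewrite xy e yz.
- move=> x y; have [->|nxy] := pselect (x = y); first by right; left.
  by case/orP: (Rtot x y) => H; [left|right; right]; split => // /esym.
- move=> P /Rmin[x [Px xmin]]; exists x; split=> // y Py [yx].
  by apply; apply: Ranti; rewrite yx xmin.
Qed.

(** The second hypothesis says that the condition at [j] only depends on the values
    below [j], so a choice of witnesses can be iterated by well-founded recursion,
    with [v0] standing for the values that are not yet defined. *)
Lemma wf_choice W (lt : W -> W -> Prop) (V : Type) (v0 : V)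
    (Q : W -> (W -> V) -> V -> Prop) :
  well_founded lt ->
  (forall j g g' v, (forall i, lt i j -> g i = g' i) -> Q j g v -> Q j g' v) ->
  (forall j g, exists v, Q j g v) ->
  exists e : W -> V, forall j, Q j e (e j).
Proof.
move=> wf Qloc Qex.
pose step j g := projT1 (cid (Qex j g)).
have stepP j g : Q j g (step j g) by rewrite /step; case: cid.
pose total j (f : forall i, lt i j -> V) i :=
  if pselect (lt i j) is left ij then f i ij else v0.
pose F j f := step j (@total j f).
exists (Fix wf (fun _ => V) F) => j.
rewrite [X in Q _ _ X]Fix_eq /F; last first.
  move=> x f g fg; congr step; apply: funext => i; rewrite /total.
  by case: pselect.
apply: Qloc (stepP _ _) => i ij; rewrite /total.
by case: pselect.
Qed.

(** * The Erdos-Rado theorem *)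

Definition increasing n W (lt : W -> W -> Prop) (s : nat -> W) :=
  forall i j, i < j < n -> lt (s i) (s j).

(** A finite sequence of length [n] is encoded as a map on [nat] of which only
    the values below [n] matter. *)
Definition agree_below n W (s s' : nat -> W) := forall i, i < n -> s i = s' i.

Definition upd W (s : nat -> W) n w : nat -> W := fun i => if i == n then w else s i.

Lemma no_injection_powerset T (f : (T -> Prop) -> T) : ~ injective f.
Proof.
move=> finj; pose D z := exists A, f A = z /\ ~ A z.
have [DD|nDD] := pselect (D (f D)).
  by have [A [/finj AD]] := DD; rewrite AD.
by apply: (nDD); exists D.
Qed.

(** For each [w] in [W], build [e] by recursion: [e j] is the least element above
    all earlier values that has, over these values, the same colours as [w], as
    long as there is one below [w], and [w] itself otherwise. If [w] is never
    reached, [e] is as required. If [w] is reached, at stage [j], then the whole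
    construction, hence [w], is determined by [j] and by the colours of [w] over
    the values of [e]; by the hypothesis on cardinalities this cannot happen for
    all [w]. *)
Lemma end_homogeneous n C W' (lt' : W' -> W' -> Prop) W (lt : W -> W -> Prop) :
  well_ordered lt' -> well_ordered lt ->
  (forall f : W -> W' * ((nat -> W') -> C), ~ injective f) ->
  forall c : (nat -> W) -> C,
  (forall s s', agree_below n.+1 s s' -> c s = c s') ->
  exists (e : W' -> W) (w : W), (forall i j, lt' i j -> lt (e i) (e j)) /\
    forall s, increasing n.+1 lt' s -> c (e \o s) = c (upd (e \o s) n w).
Proof.
move=> wo' wo big c cfin.
(* [v] may come next in the construction for [w] if [g] lists the values before
   stage [j]. *)
pose cand w (j : W') (g : W' -> W) v := (forall i, lt' i j -> lt (g i) v) /\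
  forall s : nat -> W', (forall i, i < n -> lt' (s i) j) ->
    c (upd (g \o s) n v) = c (upd (g \o s) n w).
pose minimal (P : W -> Prop) v := P v /\ forall u, P u -> ~ lt u v.
have min_uniq P u v : minimal P u -> minimal P v -> u = v.
  move=> [Pu mu] [Pv mv]; case: (wo_total wo u v) => [uv|[//|vu]].
    by case: (mv _ Pu).
  by case: (mu _ Pv).
have cong (g g' : W' -> W) s v : (forall i, i < n -> g (s i) = g' (s i) :> W) ->
    c (upd (g \o s) n v) = c (upd (g' \o s) n v).
  move=> gg'; apply: cfin => i; rewrite ltnS leq_eqVlt /upd /=.
  by case: eqP => //= _ /gg'.
have cand_loc w j g g' v : (forall i, lt' i j -> g i = g' i) ->
    cand w j g v -> cand w j g' v.
  move=> gg' [H1 H2]; split=> [i ij|s sj]; first by rewrite -gg' //; apply: H1.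
  rewrite -(cong g) => [|i /sj /gg' //]; rewrite H2 //.
  by apply: cong => i /sj /gg'.
have seq_ex w : exists e : W' -> W, forall j,
    minimal (fun v => cand w j e v \/ v = w) (e j).
  apply: (wf_choice (Q := fun j g => minimal (fun v => cand w j g v \/ v = w))
    w (well_ordered_wf wo')) => [j g g' v gg' [Pv mv]|j g].
    split; first by case: Pv => [/(cand_loc _ _ _ _ _ gg')|]; [left|right].
    move=> u Pu; apply: mv; case: Pu => [H|]; last by right.
    by left; apply: cand_loc H => i /gg' ->.
  by apply: (wo_least wo); exists w; right.
have [e eP] := choice seq_ex.
have [[w good]|bad] := pselect (exists w, forall j, e w j <> w).
  have ecand j : cand w j (e w) (e w j) by have [[//|/(good j)]] := eP w j.
  exists (e w), w; split=> [i j ij|s inc]; first by case: (ecand j) => + _; apply.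
  have [_ <-] := ecand (s n); last by move=> i ni; apply: inc; rewrite ni /=.
  by apply: cfin => i; rewrite ltnS /upd /=; case: eqP => // ->.
have hit w : exists j, e w j = w /\ forall i, lt' i j -> e w i <> w.
  have [|j [ej mj]] := wo_least wo' (P := fun j => e w j = w).
    by apply: contrapT => H; apply: bad; exists w => j ej; apply: H; exists j.
  by exists j; split => // i ij /mj.
have [J JP] := choice hit.
case: (big (fun w => (J w, fun s => c (upd (e w \o s) n w)))) => w v [Jwv gwv].
have cwv s : c (upd (e w \o s) n w) = c (upd (e v \o s) n v).
  exact: (congr1 (fun g => g s) gwv).
have cand_eq j : (forall i, lt' i j -> e w i = e v i) ->
    cand w j (e w) = cand v j (e v).
  move=> ewv; apply: funext => u; apply: propext; split=> [[H1 H2]|[H1 H2]];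
    split=> [i ij|s sj].
  - by rewrite -ewv //; apply: H1.
  - by rewrite -cwv -H2 //; apply: cong => i /sj /ewv.
  - by rewrite ewv //; apply: H1.
  - by rewrite cwv -H2 //; apply: cong => i /sj /ewv.
have min_cand u j : (forall i, lt' i j -> e u i <> u) ->
    e u j = u -> minimal (cand u j (e u)) u.
  move=> ne ej; split; last by have [_] := eP u j; rewrite ej => mu x cx; apply: mu; left.
  split=> // i ij; have nei := ne _ ij; have [_ mi] := eP u i.
  by case: (wo_total wo (e u i) u) => [//|[//|ui]]; case: (mi u) => //; right.
have min_cand' u i : e u i <> u -> minimal (cand u i (e u)) (e u i).
  move=> ne; case: (eP u i) => [[cu|//] mu]; split=> // x cx; apply: mu; by left.
have [ew nw] := JP w; have [ev nv] := JP v; rewrite -Jwv in ev nv.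
have agree i : lt' i (J w) -> e w i = e v i.
  elim/(well_founded_ind (well_ordered_wf wo')): i => i IH iJ.
  have H : cand w i (e w) = cand v i (e v).
    by apply: cand_eq => x xi; apply: IH => //; apply: wo_trans xi iJ.
  have := min_cand' w i (nw _ iJ); rewrite H => /min_uniq; apply.
  exact: min_cand' (nv _ iJ).
have := min_cand w _ nw ew; rewrite (cand_eq _ agree) => /min_uniq; apply.
exact: min_cand.
Qed.

(** The colours of length [n.+1] sequences along an end-homogeneous family only
    depend on the first [n] terms, so a homogeneous family for length [n] finishes
    the induction. The order [W0] is unconstrained because, for length [0], it is
    its own homogeneous family. *)
Theorem erdos_rado n C W0 (lt0 : W0 -> W0 -> Prop) : well_ordered lt0 ->
  exists (W : Type) (lt : W -> W -> Prop), well_ordered lt /\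
    forall c : (nat -> W) -> C,
    (forall s s', agree_below n s s' -> c s = c s') ->
    exists e : W0 -> W, (forall i j, lt0 i j -> lt (e i) (e j)) /\
      forall s s', increasing n lt0 s -> increasing n lt0 s' ->
        c (e \o s) = c (e \o s').
Proof.
move=> wo0; elim: n => [|n [W' [lt' [wo' IH]]]].
  exists W0, lt0; split=> // c cfin; exists id; split=> // s s' _ _.
  by apply: cfin.
(* Large enough for [end_homogeneous], by Cantor. *)
pose W := (W' * ((nat -> W') -> C)) -> Prop.
have [lt wo] := exists_well_order W.
exists W, lt; split=> // c cfin.
have [e [w [einc ehom]]] :=
  end_homogeneous wo' wo (@no_injection_powerset _) cfin.
have [|e' [e'inc e'hom]] := IH (fun s => c (upd (e \o s) n w)).
  move=> s s' ss'; apply: cfin => i; rewrite ltnS leq_eqVlt /upd /=.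
  by case: eqP => //= _ /ss' ->.
exists (e \o e'); split=> [i j /e'inc/einc //|s s' sinc s'inc].
have inc_e' t : increasing n.+1 lt0 t -> increasing n.+1 lt' (e' \o t).
  by move=> tinc i j /tinc /e'inc.
have inc_n t : increasing n.+1 lt0 t -> increasing n lt0 t.
  by move=> tinc i j /andP[ij jn]; apply: tinc; rewrite ij ltnW.
have -> : c (e \o e' \o s) = _ := ehom (e' \o s) (inc_e' _ sinc).
have -> : c (e \o e' \o s') = _ := ehom (e' \o s') (inc_e' _ s'inc).
by apply: (e'hom s s'); apply: inc_n.
Qed.

(** * Order-preserving maps of grids *)

Notation nat_lt := (fun m n : nat => is_true (m < n)).

(** These are the maps that preserve the quantifier-free type, in the language of
    arrays, of the [k] by [k] initial grid. *)
Definition grid_embedding k W (lt : W -> W -> Prop) (g : nat * nat -> W * W) :=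
  [/\ forall s s' t t', s < s' < k -> t < k -> t' < k ->
        lt (g (s, t)).1 (g (s', t')).1,
      forall s t t', s < k -> t < k -> t' < k -> (g (s, t)).1 = (g (s, t')).1 &
      forall s t t', s < k -> t < t' < k -> lt (g (s, t)).2 (g (s, t')).2].

Definition in_grid k (p : nat * nat) := p.1 < k /\ p.2 < k.

Definition maps_grid k m (g : nat * nat -> nat * nat) :=
  forall p, in_grid k p -> in_grid m (g p).

Lemma grid_embedding_comp k m W (lt : W -> W -> Prop) g h :
  grid_embedding k nat_lt g -> maps_grid k m g -> grid_embedding m lt h ->
  grid_embedding k lt (h \o g).
Proof.
move=> [g1 g2 g3] gm [h1 h2 h3].
have split s t : s < k -> t < k ->
    exists u v, [/\ g (s, t) = (u, v), u < m & v < m].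
  move=> sk tk; have := gm (s, t) (conj sk tk).
  by case: (g _) => u v [/= um vm]; exists u, v.
split=> [s s' t t' ss' tk t'k|s t t' sk tk t'k|s t t' sk tt'] /=.
- have /andP[lt_ss' s'k] := ss'; have sk := ltn_trans lt_ss' s'k.
  have := g1 _ _ _ _ ss' tk t'k.
  have [u [v [-> um vm]]] := split _ _ sk tk.
  have [u' [v' [-> u'm v'm]]] := split _ _ s'k t'k => /= uu'.
  by apply: h1 => //; rewrite uu'.
- have := g2 _ _ _ sk tk t'k.
  have [u [v [-> um vm]]] := split _ _ sk tk.
  have [u' [v' [-> u'm v'm]]] := split _ _ sk t'k => /= <-.
  exact: h2.
- have /andP[lt_tt' t'k] := tt'; have tk := ltn_trans lt_tt' t'k.
  have := g2 _ _ _ sk tk t'k; have := g3 _ _ _ sk tt'.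
  have [u [v [-> um vm]]] := split _ _ sk tk.
  have [u' [v' [-> u'm v'm]]] := split _ _ sk t'k => /= vv' <-.
  by apply: h3 => //; rewrite vv'.
Qed.

Lemma grid_embedding_id k : grid_embedding k nat_lt id.
Proof. by split=> // [s s' t t' /andP[]|s t t' _ /andP[]]. Qed.

Lemma bounded_on_grid k (g : nat * nat -> nat * nat) : exists m, maps_grid k m g.
Proof.
pose h (p : 'I_k * 'I_k) :=
  maxn (g (p.1 : nat, p.2 : nat)).1 (g (p.1 : nat, p.2 : nat)).2.
exists (\max_p h p).+1 => -[s t] [/= sk tk].
have := leq_bigmax (F := h) (Ordinal sk, Ordinal tk).
by rewrite geq_max => /andP[].
Qed.

(** Rank an element by the number of elements of [F] below it. *)
Lemma exists_rank W (lt : W -> W -> Prop) (F : seq W) : well_ordered lt ->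
  exists r : W -> nat, forall x y, List.In x F -> lt x y -> r x < r y.
Proof.
move=> wo; exists (fun y => count (fun x => `[< lt x y >]) F) => x y xF xy.
have mono G : count (fun z => `[< lt z x >]) G <= count (fun z => `[< lt z y >]) G.
  apply: sub_count => z /asboolP zx; apply/asboolP; exact: wo_trans zx xy.
elim: F xF => //= z F IH [->|/IH ltF].
  rewrite (asboolF (wo_irr wo (x := x))) (asboolT xy) add0n add1n ltnS.
  exact: mono.
rewrite -addnS; apply: leq_add => //.
by have := mono [:: z]; rewrite /= !addn0.
Qed.

Lemma List_In_mem (T : eqType) (x : T) s : x \in s -> List.In x s.
Proof. by elim: s => //= y s IH; rewrite inE => /orP[/eqP->|/IH]; auto. Qed.

Definition grid_coords k W (h : nat * nat -> W * W) : seq W :=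
  List.flat_map (fun p => [:: (h p).1; (h p).2])
    [seq (s, t) | s <- iota 0 k, t <- iota 0 k].

Lemma grid_embedding_rank k W (lt : W -> W -> Prop) h (r : W -> nat) :
  grid_embedding k lt h ->
  (forall x y, List.In x (grid_coords k h) -> lt x y -> r x < r y) ->
  grid_embedding k nat_lt (fun p => (r (h p).1, r (h p).2)).
Proof.
move=> [h1 h2 h3] rP.
have coord s t : s < k -> t < k -> List.In (h (s, t)).1 (grid_coords k h) /\
    List.In (h (s, t)).2 (grid_coords k h).
  move=> sk tk.
  have st : List.In (s, t) [seq (s, t) | s <- iota 0 k, t <- iota 0 k].
    by apply: List_In_mem; apply/allpairsP; exists (s, t); rewrite !mem_iota.
  by split; apply/List.in_flat_map; exists (s, t); split=> //=; auto.
split=> [s s' t t' ss' tk t'k|s t t' sk tk t'k|s t t' sk tt'] /=.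
- apply: rP; last exact: h1.
  by have /andP[lt_ss' s'k] := ss'; case: (coord s t) => //; exact: ltn_trans s'k.
- by rewrite (h2 s t t').
- apply: rP; last exact: h3.
  by have /andP[lt_tt' t'k] := tt'; case: (coord s t) => //; exact: ltn_trans t'k.
Qed.

(** If [x] and [y] are ordered in the same way on [A], then stretching by [y] at [x]
    and stretching by [x] at [y] are increasing maps of [nat] to itself that send
    [x i] and [y i], for [i] in [A], to the same number [x i + y i]. *)
Section Stretch.
Variables (n : nat) (x y : 'I_n -> nat) (A : pred 'I_n).

Definition stretch m := m + \max_(i | A i && (x i <= m)) y i.

Lemma stretch_lt m m' : m < m' -> stretch m < stretch m'.
Proof.
move=> mm'; rewrite /stretch -addSn leq_add //.
apply/bigmax_leqP => i /andP[Ai xi]; apply: (leq_bigmax_cond (F := y)).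
by rewrite Ai (leq_trans xi) // ltnW.
Qed.

Lemma stretchE i : A i -> (forall j, A j -> x j <= x i -> y j <= y i) ->
  stretch (x i) = x i + y i.
Proof.
move=> Ai yi; rewrite /stretch; congr (_ + _); apply/eqP; rewrite eqn_leq.
apply/andP; split; first by apply/bigmax_leqP => j /andP[]; apply: yi.
by apply: (leq_bigmax_cond (F := y)); rewrite Ai leqnn.
Qed.

End Stretch.

Lemma ar_term_var V (vs : V -> unit) s (t : term L_ar vs s) :
  exists v, forall e : stuple omega2 vs, eval e t = e v :> nat * nat.
Proof. by case: t => [v|[]]; exists v. Qed.

(** Equality of entries can be read off the two relations because each row and
    the set of rows are linearly ordered. *)
Lemma same_qftp_ar n (eta xi : 'I_n -> nat * nat) :
  @same_qftp L_ar omega2 omega2 n eta xi <->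
  forall i j, ((eta i).1 < (eta j).1 <-> (xi i).1 < (xi j).1) /\
    ((eta i).1 = (eta j).1 /\ (eta i).2 < (eta j).2 <->
     (xi i).1 = (xi j).1 /\ (xi i).2 < (xi j).2).
Proof.
split=> [H i j|H phi].
  pose A r : qf_formula L_ar (fun _ : 'I_n => tt) :=
    QAtom (@ARel unit L_ar _ (fun _ => tt) r
      (fun k : 'I_2 => @Var unit L_ar _ (fun _ => tt) (if k == ord0 then i else j))).
  by split; [apply: (H (A Lt1)) | apply: (H (A Lt2))].
have Heq i j : eta i = eta j <-> xi i = xi j.
  have [a1 a2] := H i j; have [b1 b2] := H j i.
  move: a1 a2 b1 b2; case: (eta i) (eta j) (xi i) (xi j) => [p q] [p' q'] [r s] [r' s'] /=.
  move=> a1 a2 b1 b2; split=> -[] ? ?; subst.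
    have E : r = r'.
      by case: (ltngtP r r') => //; [move/a1 | move/b1]; rewrite ltnn.
    subst; congr pair; case: (ltngtP s s') => // H'.
      by case: (a2.2 (conj erefl H')); rewrite ltnn.
    by case: (b2.2 (conj erefl H')); rewrite ltnn.
  have E : p = p'.
    by case: (ltngtP p p') => //; [move/a1 | move/b1]; rewrite ltnn.
  subst; congr pair; case: (ltngtP q q') => // H'.
    by case: (a2.1 (conj erefl H')); rewrite ltnn.
  by case: (b2.1 (conj erefl H')); rewrite ltnn.
elim: phi => [[s t u|r ts]|phi IH|phi IH psi IH'|phi IH psi IH'] /=; try tauto.
  have [i ti] := ar_term_var t; have [j uj] := ar_term_var u.
  have tiE e := ti e; have ujE e := uj e.
  by rewrite /= in tiE ujE *; rewrite !tiE !ujE.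
case: r ts => ts; have [i ti] := ar_term_var (ts ord0);
  have [j tj] := ar_term_var (ts ord_max).
  by rewrite /= !ti !tj; case: (H i j).
by rewrite /= !ti !tj; case: (H i j).
Qed.

Lemma same_qftp_trans n (eta xi zeta : 'I_n -> nat * nat) :
  @same_qftp L_ar omega2 omega2 n eta xi ->
  @same_qftp L_ar omega2 omega2 n xi zeta ->
  @same_qftp L_ar omega2 omega2 n eta zeta.
Proof. by move=> H1 H2 phi; rewrite (H1 phi) (H2 phi). Qed.

Lemma same_qftp_grid k g n (eta : 'I_n -> nat * nat) :
  grid_embedding k nat_lt g -> (forall i, in_grid k (eta i)) ->
  @same_qftp L_ar omega2 omega2 n eta (g \o eta).
Proof.
move=> [g1 g2 g3] etak; apply/same_qftp_ar => i j /=.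
have := etak i; have := etak j; rewrite /in_grid.
case: (eta i) (eta j) => [p q] [p' q'] /= [p'k q'k] [pk qk].
have g1' a b c d : a < k -> b < k -> c < k -> d < k ->
    a < b -> (g (a, c)).1 < (g (b, d)).1.
  by move=> ak bk ck dk ab; apply: g1 => //; rewrite ab.
have cmp1 : p < p' <-> (g (p, q)).1 < (g (p', q')).1.
  split; first exact: g1'.
  case: (ltngtP p p') => // [pp'|->].
    by move/ltn_trans=> /(_ _ (g1' _ _ _ _ p'k pk q'k qk pp')); rewrite ltnn.
  by rewrite (g2 p' q q') // ltnn.
split=> //; split=> -[].
  by move=> pp'; subst => qq'; split; [exact: g2 | apply: g3; rewrite ?qq'].
move=> E lt_g; have pp' : p = p'.
  case: (ltngtP p p') => // pp'.
    by have := g1' _ _ _ _ pk p'k qk q'k pp'; rewrite E ltnn.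
  by have := g1' _ _ _ _ p'k pk q'k qk pp'; rewrite E ltnn.
subst; split=> //; case: (ltngtP q q') => // [qq'|qq'].
  have : (g (p', q')).2 < (g (p', q)).2 by apply: g3; rewrite ?qq'.
  by move/(ltn_trans lt_g); rewrite ltnn.
by move: lt_g; rewrite qq' ltnn.
Qed.

Definition stretch_grid n (eta xi : 'I_n -> nat * nat) (p : nat * nat) :=
  (stretch (fun i => (eta i).1) (fun i => (xi i).1) predT p.1,
   stretch (fun i => (eta i).2) (fun i => (xi i).2)
     (fun i => (eta i).1 == p.1) p.2).

Lemma stretch_grid_embedding k n (eta xi : 'I_n -> nat * nat) :
  grid_embedding k nat_lt (stretch_grid eta xi).
Proof.
split=> [s s' t t' /andP[ss' _] _ _|//|s t t' _ /andP[tt' _]] /=; exact: stretch_lt.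
Qed.

Lemma stretch_gridE n (eta xi : 'I_n -> nat * nat) i :
  @same_qftp L_ar omega2 omega2 n eta xi ->
  stretch_grid eta xi (eta i) = ((eta i).1 + (xi i).1, (eta i).2 + (xi i).2).
Proof.
move=> /same_qftp_ar H; congr pair.
  apply: (stretchE (x := fun i => (eta i).1) (y := fun i => (xi i).1)) => // j _.
  have [h _] := H i j; rewrite leqNgt => /negP nlt; rewrite leqNgt.
  by apply/negP => /h.
apply: (stretchE (x := fun i => (eta i).2) (y := fun i => (xi i).2)
  (A := fun j => (eta j).1 == (eta i).1)) => [|j /eqP eij] //.
rewrite leqNgt => /negP nlt; rewrite leqNgt; apply/negP => lt_xi; apply: nlt.
have [h1 h2] := H i j; have [h1' _] := H j i.
have [|_ //] := h2.2 _.
split=> //; case: (ltngtP (xi i).1 (xi j).1) => //.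
  by move/h1; rewrite eij ltnn.
by move/h1'; rewrite eij ltnn.
Qed.

(** Stretch the rows, and then the columns of each row, of each tuple by those of
    the other. *)
Lemma same_qftp_amalgam n (eta xi : 'I_n -> nat * nat) :
  @same_qftp L_ar omega2 omega2 n eta xi ->
  exists f g : nat * nat -> nat * nat,
    [/\ forall k, grid_embedding k nat_lt f, forall k, grid_embedding k nat_lt g &
        f \o eta = g \o xi].
Proof.
move=> H; exists (stretch_grid eta xi), (stretch_grid xi eta).
split; [by move=> k; apply: stretch_grid_embedding..|].
apply: funext => i /=; rewrite !stretch_gridE //; first by congr pair; rewrite addnC.
by move=> phi; rewrite (H phi).
Qed.

(** * Coding a grid of a well-ordered square by an increasing sequence *)

Lemma well_ordered_nat : well_ordered nat_lt.
Proof.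
split.
- by move=> x; rewrite ltnn.
- by move=> x y z; apply: ltn_trans.
- by move=> x y; case: (ltngtP x y); auto.
- move=> P [n Pn]; have ex : exists n, `[< P n >] by exists n; apply/asboolP.
  case: (ex_minnP ex) => m /asboolP Pm mmin; exists m; split=> // k Pk.
  by rewrite ltnNge mmin //; apply/asboolP.
Qed.

Definition lex_lt (p q : nat * nat) := p.1 < q.1 \/ p.1 = q.1 /\ p.2 < q.2.

Lemma well_ordered_lex : well_ordered lex_lt.
Proof.
rewrite /lex_lt; split.
- by move=> [x y] /= [|[_]]; rewrite ltnn.
- move=> [x y] [x' y'] [x'' y''] /= [xx'|[-> yy']] [x'x''|[<- y'y'']].
  + by left; apply: ltn_trans x'x''.
  + by left.
  + by left.
  + by right; split=> //; apply: ltn_trans y'y''.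
- move=> [x y] [x' y'] /=; case: (ltngtP x x') => [||->]; auto.
  by case: (ltngtP y y') => [||->]; auto.
- move=> P [[x y] Pxy]; have least := wo_least well_ordered_nat.
  have [m [[n Pmn] mmin]] := least (fun x => exists y, P (x, y))
    (ex_intro _ x (ex_intro _ y Pxy)).
  have [n' [Pmn' n'min]] := least (fun y => P (m, y)) (ex_intro _ n Pmn).
  exists (m, n'); split=> // -[u v] Puv /= [um|[um vn]].
    by apply: (mmin u) um; exists v.
  by subst; apply: n'min vn.
Qed.

(** The first [k] terms of [w] are the rows; row [s] then receives the block of
    [k] terms that starts at [k + s * k] as its entries. *)
Definition grid_of k W (w : nat -> W) (p : nat * nat) : W * W :=
  (w p.1, w (k + (p.1 * k + p.2))).

(** The sequence of which [grid_of k] is the image of the [k]-grid under [g], when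
    row [s] of an array is placed at [(0, s)] and its entries [t] are placed at
    [(s.+1, t)]. Row markers come first and rows follow in order, which makes the
    sequence lexicographically increasing. *)
Definition lex_code k (g : nat * nat -> nat * nat) (i : nat) : nat * nat :=
  if i < k then (0, (g (i, 0)).1)
  else ((g ((i - k) %/ k, 0)).1.+1, (g ((i - k) %/ k, (i - k) %% k)).2).

Lemma lex_code_increasing k g : grid_embedding k nat_lt g ->
  increasing (k + k * k) lex_lt (lex_code k g).
Proof.
move=> [g1 g2 g3] i j /andP[ij jn]; rewrite /lex_code.
case: (ltnP j k) => [jk|kj].
  rewrite (ltn_trans ij jk); right; split=> //=.
  by apply: g1; rewrite ?ij ?jk // (leq_ltn_trans _ jk).
case: (ltnP i k) => [ik|ki]; first by left.
have k0 : 0 < k by case: (k) jn => //; rewrite ltn0.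
have jkk : (j - k) < k * k by rewrite ltn_subLR.
have djk : (j - k) %/ k < k by rewrite ltn_divLR.
have ijk : i - k < j - k by rewrite ltn_sub2r // (leq_ltn_trans ki).
rewrite /lex_lt /=; have := leq_div2r k (ltnW ijk); rewrite leq_eqVlt.
case/orP=> [/eqP dij|dij]; last by left; rewrite ltnS; apply: g1; rewrite ?dij.
right; rewrite dij; split=> //; apply: g3 => //; rewrite ltn_pmod // andbT.
by move: ijk; rewrite {1}(divn_eq (i - k) k) {1}(divn_eq (j - k) k) dij ltn_add2l.
Qed.

Lemma grid_of_lex_code k g W (e : nat * nat -> W) p :
  grid_embedding k nat_lt g -> in_grid k p ->
  grid_of k (e \o lex_code k g) p = (e (0, (g p).1), e ((g p).1.+1, (g p).2)).
Proof.
case: p => s t [_ g2 _] [/= sk tk].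
rewrite /grid_of /lex_code /= sk ltnNge leq_addr /= addKn.
have k0 : 0 < k by apply: leq_ltn_trans sk.
rewrite divnMDl // (divn_small tk) addn0 modnMDl (modn_small tk).
by rewrite (g2 s 0 t).
Qed.

(** * Maximal families *)

Local Open Scope classical_set_scope.

Lemma maximal_family T (G : set T -> Prop) (F0 : set T) :
  G F0 ->
  (forall C : set (set T), C !=set0 -> C `<=` G -> total_on C subset ->
     G (\bigcup_(A in C) A)) ->
  exists F, [/\ G F, F0 `<=` F & forall F', G F' -> F `<=` F' -> F' = F].
Proof.
move=> G0 Gchain.
have [C CG Ctot|A [GA Amax]] := @Zorn_bigcup T (fun A => G (F0 `|` A)).
  have [->|/set0P C0] := eqVneq C set0; first by rewrite bigcup_set0 setU0.
  have -> : F0 `|` \bigcup_(A in C) A =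
      \bigcup_(A in [set F0 `|` A | A in C]) A.
    have [A0 CA0] := C0; rewrite eqEsubset; split=> x.
      case=> [F0x|[A CA Ax]]; [exists (F0 `|` A0)|exists (F0 `|` A)] => //.
      - by exists A0.
      - by left.
      - by exists A.
      - by right.
    by case=> _ [A CA <-] [F0x|Ax]; [left|right; exists A].
  apply: Gchain.
  - by have [A0 CA0] := C0; exists (F0 `|` A0); exists A0.
  - by move=> _ [A CA <-]; apply: CG.
  - move=> _ _ [A CA <-] [B CB <-].
    by case: (Ctot A B CA CB) => H; [left|right]; apply: setUS.
exists (F0 `|` A); split=> // F' GF' sub; apply: contrapT => neq.
apply: (Amax F').
  split; first by move=> x Ax; apply: sub; right.
  by move=> F'A; apply: neq; rewrite eqEsubset; split=> // x /F'A; right.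
by rewrite setUidr // => x F0x; apply: sub; left.
Qed.

(** Families of plain properties and families of properties marked with the size of
    a grid are both of this form. *)
Definition fin_sat T Z (holds : T -> Z -> Prop) (F : set T) :=
  forall l : seq T, (forall t, List.In t l -> F t) ->
    exists z, forall t, List.In t l -> holds t z.

Lemma fin_sat_chain T Z (holds : T -> Z -> Prop) (C : set (set T)) :
  C !=set0 -> (forall A, C A -> fin_sat holds A) -> total_on C subset ->
  fin_sat holds (\bigcup_(A in C) A).
Proof.
move=> [A0 CA0] Cfs Ctot l lC.
suff [A [CA lA]] : exists A, C A /\ forall t, List.In t l -> A t.
  exact: (Cfs A).
elim: l lC => [|t l IH] lC; first by exists A0.
have [|A [CA lA]] := IH; first by move=> u ul; apply: lC; right.
have [B CB Bt] := lC t (or_introl erefl).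
case: (Ctot A B CA CB) => H.
  by exists B; split=> // u /= [<-//|/lA/H].
by exists A; split=> // u /= [<-|/lA //]; apply: H.
Qed.

(** * Cardinality of the set of variables of an array *)

Lemma infinite_sequence X (A : set X) : infinite_set A ->
  exists f : nat -> X, injective f /\ forall i, A (f i).
Proof.
move=> /infiniteP/card_leP[f].
exists (fun i => val (f (SigSub (mem_set (I : [set: nat] i))))); split.
  by move=> i j /val_inj /(@inj _ _ _ f); rewrite !inE => /(_ I I) [].
by move=> i; apply: set_mem; apply: valP.
Qed.

(** Take a maximal set [F] of injective sequences with disjoint ranges. Only
    finitely many points are not covered, and they can be put into one of the
    sequences, so [X] embeds into [F * nat] and the factor [nat] is absorbed. *)
Lemma nat_prod_injection X : infinite_set [set: X] ->
  exists f : nat * X -> X, injective f.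
Proof.
move=> infX.
pose G (F : set (nat -> X)) :=
  forall f g i j, F f -> F g -> f i = g j -> f = g /\ i = j.
have [|C _ CG Ctot|F [GF _ Fmax]] := @maximal_family _ G set0.
- by [].
- move=> f g i j [A CA Af] [B CB Bg].
  by case: (Ctot A B CA CB) => H; [apply: (CG B) => //|apply: (CG A) => //]; apply: H.
pose R := [set x | ~ exists f i, F f /\ f i = x].
have finR : finite_set R.
  apply: contrapT => /infinite_sequence[f [finj fR]].
  have Ff : F f.
    have <- : F `|` [set f] = F; last by right.
    apply: Fmax; last exact: subsetUl.
    move=> g h i j [Fg|->] [Fh|->].
    - exact: GF.
    - by move=> gf; case: (fR j); exists g, i.
    - by move=> fh; case: (fR i); exists h, j.
    - by move=> /finj.
  by apply: (fR 0); exists f, 0.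
have [f0 F0] : exists f, F f.
  apply: contrapT => F0; apply: infX; suff -> : [set: X] = R by [].
  by rewrite eqEsubset; split=> // x _ [f [i [Ff _]]]; apply: F0; exists f.
have /countable_injP[r rinj] := finite_set_countable finR.
(* Points on a sequence get even codes; the others get odd codes on [f0]. *)
have enc x : exists p : (nat -> X) * nat, F p.1 /\
    (p.1 p.2./2 = x /\ odd p.2 = false \/
     [/\ R x, odd p.2 & p.2 = (r x).*2.+1]).
  have [[f [i [Ff fi]]]|Rx] := pselect (exists f i, F f /\ f i = x).
    by exists (f, i.*2); split=> //; left; rewrite doubleK odd_double.
  by exists (f0, (r x).*2.+1); split=> //; right; rewrite /= odd_double.
have {enc}[e eP] := choice enc.
have einj : injective e.
  move=> x y exy; have [_] := eP x; have [_] := eP y; rewrite exy.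
  move=> [[ey o]|[Ry o ey]] [[ex o']|[Rx o' ex]].
  - exact: etrans (esym ex) ey.
  - by move: o'; rewrite o.
  - by move: o'; rewrite o.
  by apply: rinj; rewrite ?inE //; move: ey; rewrite ex => -[] /double_inj.
exists (fun p => (e p.2).1 (pickle (p.1, (e p.2).2))) => -[m x] [n y] /=.
have [Fx _] := eP x; have [Fy _] := eP y.
move=> /(GF _ _ _ _ Fx Fy)[ef /(pcan_inj pickleK) [-> en]].
by congr pair; apply: einj; move: ef en; case: (e x) (e y) => ? ? [? ?] /= -> ->.
Qed.

Local Close Scope classical_set_scope.

Lemma grid_prod_card_lt X K :
  card_lt nat K -> card_lt X K -> card_lt ((nat * nat) * X) K.
Proof.
move=> [[i iinj] noK] [[j jinj] noX].
have [finX|infX] := pselect (finite_set [set: X]).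
  have /countable_injP[r rinj] := finite_set_countable finX.
  pose h (p : nat * nat * X) := pickle (p.1, r p.2).
  have hinj : injective h.
    move=> [a x] [b y] /(pcan_inj pickleK)[-> /rinj ->] //; by rewrite inE.
  split; first by exists (i \o h); apply: inj_comp.
  by move=> [g ginj]; apply: noK; exists (h \o g); apply: inj_comp.
have [f finj] := nat_prod_injection infX.
pose h (p : nat * nat * X) := f (pickle p.1, p.2).
have hinj : injective h.
  by move=> [a x] [b y] /finj[/(pcan_inj pickleK) -> ->].
split; first by exists (j \o h); apply: inj_comp.
by move=> [g ginj]; apply: noX; exists (h \o g); apply: inj_comp.
Qed.

(** * Renaming, support and projection of positive formulas *)

Section Formulas.
Variables (S : Type) (L : language S) (M : structure L).

(** Comparison in the total space of [M] avoids transporting values along the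
    equality of the sorts of [v] and [r v]. *)
Definition same_values V (vs : V -> S) V' (vs' : V' -> S) (r : V -> V')
    (e : stuple M vs) (e' : stuple M vs') :=
  forall v, existT M (vs v) (e v) = existT M (vs' (r v)) (e' (r v)).

Lemma rename_term V (vs : V -> S) V' (vs' : V' -> S) (r : V -> V')
    (Hr : forall v, vs v = vs' (r v)) s (t : term L vs s) :
  exists t' : term L vs' s, forall e e', same_values r e e' ->
    eval e t = eval e' t' :> M s.
Proof.
elim: t => [v|f ts IH].
  exists (eq_rect _ (term L vs') (Var L vs' (r v)) _ (esym (Hr v))) => e e' /(_ v).
  rewrite /=; move: (e v); case: _ / (esym (Hr v)) => m.
  exact: Eqdep.EqdepTheory.inj_pair2.
exists (App (fun i => projT1 (cid (IH i)))) => e e' ee' /=.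
congr fun_interp; apply: functional_extensionality_dep => i.
by case: (cid (IH i)) => t' /= E; apply: E.
Qed.

Lemma rename_formula V (vs : V -> S) (phi : formula L vs) V' (vs' : V' -> S)
    (r : V -> V') (Hr : forall v, vs v = vs' (r v)) :
  exists phi' : formula L vs', forall (e : stuple M vs) (e' : stuple M vs'),
    same_values r e e' -> sat phi e <-> sat phi' e'.
Proof.
elim: phi V' vs' r Hr => {V vs} [V vs [s t u|R ts]|V vs|V vs
  |V vs phi IH psi IH'|V vs phi IH psi IH'|V vs s phi IH] V' vs' r Hr.
- have [t' tE] := rename_term Hr t; have [u' uE] := rename_term Hr u.
  by exists (Atom (AEq t' u')) => e e' ee' /=; rewrite (tE _ _ ee') (uE _ _ ee').
- have H i := cid (rename_term Hr (ts i)).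
  exists (Atom (ARel (fun i => projT1 (H i)))) => e e' ee' /=.
  suff -> : (fun i => eval e (ts i)) = fun i => eval e' (projT1 (H i)) by [].
  apply: functional_extensionality_dep => i.
  by case: (H i) => t' /= E; apply: E.
- by exists (Top _ _).
- by exists (Bot _ _).
- have [phi' E] := IH _ _ _ Hr; have [psi' E'] := IH' _ _ _ Hr.
  by exists (And phi' psi') => e e' ee' /=; rewrite (E _ _ ee') (E' _ _ ee').
- have [phi' E] := IH _ _ _ Hr; have [psi' E'] := IH' _ _ _ Hr.
  by exists (Or phi' psi') => e e' ee' /=; rewrite (E _ _ ee') (E' _ _ ee').
- have Hr' o : ext_sort vs s o = ext_sort vs' s (omap r o) by case: o.
  have [phi' E] := IH _ _ _ Hr'; exists (Ex phi') => e e' ee' /=.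
  have ext (m : M s) : same_values (omap r) (ext_tuple e m) (ext_tuple e' m).
    by case=> [v|] //=; apply: ee'.
  by split=> -[m /(E _ _ (ext m)) Hm]; exists m.
Qed.

Lemma term_support V (vs : V -> S) s (t : term L vs s) :
  exists F : seq V, forall e e' : stuple M vs,
    (forall v, List.In v F -> e v = e' v) -> eval e t = eval e' t.
Proof.
elim: t => [v|f ts /choice[F FP]].
  by exists [:: v] => e e'; apply; left.
exists (List.flat_map F (enum 'I_(farity f))) => e e' ee' /=.
congr fun_interp; apply: functional_extensionality_dep => i; apply: FP => v vF.
apply: ee'; apply/List.in_flat_map; exists i; split=> //.
by apply: List_In_mem; rewrite mem_enum.
Qed.

Lemma formula_support V (vs : V -> S) (phi : formula L vs) :
  exists F : seq V, forall e e' : stuple M vs,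
    (forall v, List.In v F -> e v = e' v) -> sat phi e <-> sat phi e'.
Proof.
elim: phi => {V vs} [V vs [s t u|R ts]|V vs|V vs
  |V vs phi [F FP] psi [F' FP']|V vs phi [F FP] psi [F' FP']|V vs s phi [F FP]].
- have [F FP] := term_support t; have [F' FP'] := term_support u.
  exists (F ++ F') => e e' ee' /=; rewrite (FP e e') ?(FP' e e') // => v vF;
    apply: ee'; apply/List.in_or_app; auto.
- have /choice[F FP] := fun i => term_support (ts i).
  exists (List.flat_map F (enum 'I_(rarity R))) => e e' ee' /=.
  suff -> : (fun i => eval e (ts i)) = fun i => eval e' (ts i) by [].
  apply: functional_extensionality_dep => i; apply: FP => v vF; apply: ee'.
  by apply/List.in_flat_map; exists i; split=> //; apply: List_In_mem; rewrite mem_enum.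
- by exists [::].
- by exists [::].
- exists (F ++ F') => e e' ee' /=; rewrite (FP e e') ?(FP' e e') // => v vF;
    apply: ee'; apply/List.in_or_app; auto.
- exists (F ++ F') => e e' ee' /=; rewrite (FP e e') ?(FP' e e') // => v vF;
    apply: ee'; apply/List.in_or_app; auto.
- have Hpmap (G : seq (option V)) v : List.In (Some v) G -> List.In v (pmap id G).
    by elim: G => //= -[w|] G IHG [[->]|/IHG] //=; auto.
  exists (pmap id F) => e e' ee' /=.
  have ext (m : M s) : sat phi (ext_tuple e m) <-> sat phi (ext_tuple e' m).
    apply: FP => -[v|] //= vF; apply: ee'.
    exact: Hpmap.
  by split=> -[m /ext]; exists m.
Qed.

Lemma project_variable V (vs : V -> S) (phi : formula L vs) (v0 : V) :
  exists psi : formula L vs, forall e : stuple M vs,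
    sat psi e <->
    exists e', (forall v, v <> v0 -> e' v = e v) /\ sat phi e'.
Proof.
(* Turn [v0] into the variable [None] that the quantifier binds. *)
pose r v := if pselect (v = v0) then None else Some v.
have Hr v : vs v = ext_sort vs (vs v0) (r v).
  by rewrite /r; case: pselect => [vv0|//]; rewrite /= vv0.
have [phi' E] := rename_formula phi Hr; exists (Ex phi') => e /=.
split=> [[m Hm]|[e' [ee' He']]].
  pose e' v : M (vs v) := match pselect (v = v0) with
    | left H => eq_rect_r (fun v => M (vs v)) m H | right _ => e v end.
  exists e'; split=> [v nv|]; first by rewrite /e'; case: pselect.
  apply/(E e' (ext_tuple e m)) => // v; rewrite /e' /r.
  by case: pselect => //= H; subst.
exists (e' v0); apply/(E e') => // v; rewrite /r.
by case: pselect => [vv0|/ee' -> //]; subst.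
Qed.

(** Existential quantification over the variables in [F], which remain present as
    dummy variables of [psi]. *)
Lemma project_variables V (vs : V -> S) (phi : formula L vs) (F : seq V) :
  exists psi : formula L vs, forall e : stuple M vs,
    sat psi e <->
    exists e', (forall v, ~ List.In v F -> e' v = e v) /\ sat phi e'.
Proof.
elim: F => [|v0 F [psi IH]].
  exists phi => e; split=> [He|[e' [ee' He']]]; first by exists e.
  suff -> : e = e' by [].
  by apply: functional_extensionality_dep => v; rewrite ee'.
have [psi' E] := project_variable psi v0; exists psi' => e; rewrite E.
split=> [[e1 [ee1 /IH [e2 [e12 He2]]]]|[e2 [ee2 He2]]].
  exists e2; split=> // v /= nv; rewrite e12 ?ee1 // => H; apply: nv; auto.
pose e1 v : M (vs v) := if pselect (v = v0) then e2 v else e v.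
exists e1; split=> [v nv|]; first by rewrite /e1; case: pselect.
apply/IH; exists e2; split=> // v nv; rewrite /e1; case: pselect => // nv0.
by apply: ee2 => -[/esym|].
Qed.

End Formulas.

(** * Definable properties of families *)

Section Definable.
Variables (S : Type) (L : language S) (M : structure L) (E : pset M).
Variables (X : Type) (xs : X -> S).
Local Notation Y := (stuple M xs).

(** The formula of a definable property is written in all the variables [I * X],
    so that conjunction and compactness apply without renaming; finite tuples of
    indices are the case of [I] an ordinal. *)
Definition flatten_family I (c : I -> Y) : stuple M (fun w : I * X => xs w.2) :=
  fun w => c w.1 w.2.

Definition definable I (P : (I -> Y) -> Prop) :=
  exists phi : formula_over E (fun w : I * X => xs w.2),
    forall c, P c <-> sat_over phi (flatten_family c).

Lemma definable_true I : definable (fun _ : I -> Y => True).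
Proof. by exists (Top _ _). Qed.

Lemma definable_and I (P Q : (I -> Y) -> Prop) :
  definable P -> definable Q -> definable (fun c => P c /\ Q c).
Proof.
move=> [phi HP] [psi HQ]; exists (And phi psi) => c.
by rewrite HP HQ.
Qed.

Lemma definable_pullback I J (f : I -> J) (P : (I -> Y) -> Prop) :
  definable P -> definable (fun c : J -> Y => P (c \o f)).
Proof.
move=> [phi HP].
pose r (w : I * X + elt E) : J * X + elt E :=
  match w with inl (i, x) => inl (f i, x) | inr p => inr p end.
have Hr w : over_sort (fun w : I * X => xs w.2) w =
    over_sort (fun w : J * X => xs w.2) (r w) by case: w => [[i x]|p].
have [phi' H] := rename_formula M phi Hr; exists phi' => c.
by rewrite HP; apply: H => -[[i x]|p].
Qed.

(** The formula mentions finitely many variables, and only those indexed outside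
    [A] have to be quantified. *)
Lemma definable_project I (A : I -> Prop) (P : (I -> Y) -> Prop) :
  definable P ->
  definable (fun c => exists c', (forall i, A i -> c' i = c i) /\ P c').
Proof.
move=> [phi HP]; have [F FP] := formula_support M phi.
pose out (w : I * X + elt E) : bool :=
  match w with inl (i, x) => ~~ `[< A i >] | inr _ => false end.
have [psi H] := project_variables M phi (filter out F); exists psi => c.
have In_filter w : List.In w (filter out F) <-> List.In w F /\ out w.
  elim: F {FP H} => [|u F IH] /=; first by tauto.
  case: ifP => ou /=; rewrite IH; first by split=> [[<-|]|]; tauto.
  by split=> [|[[uw|]]]; [tauto|rewrite -uw ou|tauto].
rewrite /sat_over H; split=> [[c' [cc' Pc']]|[e' [ee' He']]].
  pose e' w : M (over_sort (fun w : I * X => xs w.2) w) :=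
    if pselect (List.In w (filter out F))
    then over_tuple (flatten_family c') w else over_tuple (flatten_family c) w.
  exists e'; split=> [w nw|]; first by rewrite /e'; case: pselect.
  apply/(FP e' (over_tuple (flatten_family c'))); last exact/HP.
  move=> w wF; rewrite /e'; case: pselect => // nw.
  have: ~~ out w by apply/negP => ow; apply: nw; apply/In_filter.
  case: w wF nw => [[i x]|p] //= _ _; rewrite negbK => /asboolP Ai.
  by rewrite /flatten_family /= cc'.
exists (fun i x => e' (inl (i, x))); split=> [i Ai|].
  apply: functional_extensionality_dep => x; rewrite ee' // => /In_filter[_] /=.
  by rewrite asboolT.
apply/HP; rewrite /sat_over; suff -> : over_tuple
  (flatten_family (fun (i : I) x => e' (inl (i, x)))) = e' by [].
apply: functional_extensionality_dep => -[[i x]|p] //=.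
by rewrite ee' // => /In_filter[].
Qed.

Lemma definable_realised K I (F : ((I -> Y) -> Prop) -> Prop) :
  saturated K M -> card_lt (elt E) K -> card_lt (I * X) K ->
  (forall P, F P -> definable P) ->
  (forall l, (forall P, List.In P l -> F P) ->
     exists c, forall P, List.In P l -> P c) ->
  exists c, forall P, F P -> P c.
Proof.
move=> sat_M EK IK Fdef Ffs.
pose Sigma (phi : formula_over E (fun w : I * X => xs w.2)) :=
  F (fun c => sat_over phi (flatten_family c)).
have [|e He] := sat_M E (I * X)%type (fun w => xs w.2) Sigma EK IK.
  move=> l lS.
  have [|c Hc] := Ffs (List.map (fun phi c => sat_over phi (flatten_family c)) l).
    by move=> P /List.in_map_iff[phi [<- /lS]].
  exists (flatten_family c) => phi phil.
  by apply: (Hc (fun c => sat_over phi (flatten_family c)));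
    apply/List.in_map_iff; exists phi.
exists (fun i x => e (i, x)) => P FP.
have [phi HP] := Fdef P FP.
have PE : P = fun c => sat_over phi (flatten_family c).
  by apply: funext => c; apply: propext.
rewrite HP; suff -> : flatten_family (fun i x => e (i, x)) = e.
  by apply: He; rewrite /Sigma -PE.
by apply: functional_extensionality_dep => -[].
Qed.

End Definable.

(** * Coherent families of properties of grids *)

Local Open Scope classical_set_scope.

Section Modelling.
Variables (S : Type) (L : language S) (M : structure L) (E : pset M).
Variables (X : Type) (xs : X -> S).
Local Notation Y := (stuple M xs).
Local Notation definable := (definable E).

Definition pull I J (h : I -> J) (P : (I -> Y) -> Prop) : (J -> Y) -> Prop :=
  fun c => P (c \o h).

Definition on_grid k (P : (nat * nat -> Y) -> Prop) := definable P /\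
  forall c c', (forall p, in_grid k p -> c p = c' p) -> P c -> P c'.

Lemma on_grid_pull_eq k P I (h h' : nat * nat -> I) :
  on_grid k P -> (forall p, in_grid k p -> h p = h' p) -> pull h P = pull h' P.
Proof.
move=> [_ PP] hh'; apply: funext => c; apply: propext.
by split; apply: PP => p pk /=; rewrite hh'.
Qed.

Lemma on_grid_pull k m P g :
  on_grid k P -> maps_grid k m g -> on_grid m (pull g P).
Proof.
move=> [dP PP] gkm; split; first exact: definable_pullback.
by move=> c c' cc'; apply: PP => p pk /=; apply/cc'/gkm.
Qed.

(** The size [k] is recorded because a property may be local to several grids, and
    maps that preserve the order on one of them need not do so on a larger
    one. *)
Definition family_pair : Type := nat * ((nat * nat -> Y) -> Prop).

Definition coherent (G : set family_pair) :=
  [/\ forall k P, G (k, P) -> on_grid k P,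
      forall k m P g, G (k, P) -> grid_embedding k nat_lt g ->
        maps_grid k m g -> G (m, pull g P) &
      fin_sat (fun q c => q.2 c) G].

Lemma maximal_coherent G0 : coherent G0 ->
  exists G, [/\ coherent G, G0 `<=` G &
    forall G', coherent G' -> G `<=` G' -> G' = G].
Proof.
move=> coh0; apply: maximal_family coh0 _ => C C0 Ccoh Ctot; split.
- by move=> k P [A /Ccoh[+ _ _]]; apply.
- move=> k m P g [A CA AP] emb gkm; exists A => //.
  by have [_ H _] := Ccoh A CA; apply: H AP emb gkm.
- by apply: fin_sat_chain => // A /Ccoh[].
Qed.

Definition definable_type I (F : set ((I -> Y) -> Prop)) :=
  F `<=` definable (I := I) /\ fin_sat id F.

Lemma maximal_definable_type I (F0 : set ((I -> Y) -> Prop)) :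
  definable_type F0 -> exists F, [/\ definable_type F, F0 `<=` F &
    forall F', definable_type F' -> F `<=` F' -> F' = F].
Proof.
move=> F0P; apply: maximal_family F0P _ => C C0 CP Ctot; split.
- by move=> P [A /CP[+ _]]; apply.
- by apply: fin_sat_chain => // A /CP[].
Qed.

Section MaximalType.
Variables (I : Type) (F : set ((I -> Y) -> Prop)).
Hypothesis FP : definable_type F.
Hypothesis Fmax : forall F', definable_type F' -> F `<=` F' -> F' = F.

(** In positive logic this replaces the statement that a complete type contains
    the negation of each formula outside it. *)
Lemma maximal_inconsistent Q : definable Q -> ~ F Q ->
  exists l, (forall R, List.In R l -> F R) /\
    forall c, (forall R, List.In R l -> R c) -> ~ Q c.
Proof.
move=> dQ nFQ; apply: contrapT => H; apply: nFQ.
suff FQ : F `|` [set Q] = F by rewrite -FQ; right.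
apply: Fmax; last exact: subsetUl; split=> [R [/(FP.1)|->]//|l lF].
pose l' := [seq R <- l | `[< F R >]].
have l'P R : List.In R l -> F R -> List.In R l'.
  rewrite /l'; elim: l {lF l'} => //= R' l IH [->|Rl] FR; last first.
    by case: ifP => _; [right|]; apply: IH.
  by rewrite asboolT //; left.
apply: contrapT => nc; apply: H; exists l'; split.
  by rewrite /l' => R /List.filter_In[_ /asboolP].
move=> c cl' Qc; apply: nc; exists c => R Rl.
by case: (lF R Rl) => [FR|->]; [apply: cl' (l'P R Rl FR)|exact: Qc].
Qed.

Lemma maximal_implied l R : (forall Q, List.In Q l -> F Q) -> definable R ->
  (forall c, (forall Q, List.In Q l -> Q c) -> R c) -> F R.
Proof.
move=> lF dR lR; apply: contrapT => /(maximal_inconsistent dR)[l' [l'F l'R]].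
have [|c Hc] := FP.2 (l ++ l').
  by move=> Q Qll; case: (List.in_app_or _ _ _ Qll) => [/lF|/l'F].
apply: (l'R c) => [Q Ql'|]; first by apply: (Hc Q); apply/List.in_or_app; right.
by apply: lR => Q Ql; apply: (Hc Q); apply/List.in_or_app; left.
Qed.

End MaximalType.

Lemma definable_conj I (l : seq ((I -> Y) -> Prop)) :
  (forall Q, List.In Q l -> definable Q) ->
  definable (fun c => forall Q, List.In Q l -> Q c).
Proof.
elim: l => [|Q l IH] ld.
  have -> : (fun c : I -> Y => forall Q, List.In Q [::] -> Q c) = fun=> True.
    by apply: funext => c; apply: propext.
  exact: definable_true.
have -> : (fun c => forall R, List.In R (Q :: l) -> R c) =
    fun c => Q c /\ forall R, List.In R l -> R c.
  apply: funext => c; apply: propext; split=> [H|[Qc H] R [<-//|/H //]].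
  by split=> [|R Rl]; apply: H; [left|right].
by apply: definable_and; [apply: ld; left|apply: IH => R Rl; apply: ld; right].
Qed.

(** Finitely many of these properties concern finitely many elements of [W], which
    can be ranked in [nat]; reading a realisation [b] of [G] through the ranks
    satisfies them all. *)
Lemma stretched_fin_sat (G : set family_pair) W (lt : W -> W -> Prop) :
  well_ordered lt -> coherent G -> (exists b, forall k P, G (k, P) -> P b) ->
  definable_type [set Q | exists m R h,
    [/\ G (m, R), grid_embedding m lt h & Q = pull h R]].
Proof.
move=> wo [Ggrid Ginv _] [b Gb]; split.
  by move=> _ [m [R [h [/Ggrid[dR _] _ ->]]]]; apply: definable_pullback.
move=> l lG.
suff [C HC] : exists C : seq W, forall r : W -> nat,
    (forall x y, List.In x C -> lt x y -> r x < r y) ->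
    forall Q, List.In Q l -> Q (fun w => b (r w.1, r w.2)).
  by have [r /HC] := exists_rank C wo; exists (fun w => b (r w.1, r w.2)).
elim: l lG => [|Q l IH] lG; first by exists [::].
have [|C HC] := IH; first by move=> R Rl; apply: lG; right.
have [m [R [h [GR hemb ->]]]] := lG Q (or_introl erefl).
exists (grid_coords m h ++ C) => r rC Q' [<-|Q'l]; last first.
  by apply: HC Q'l => x y xC; apply/rC/List.in_or_app; right.
have remb : grid_embedding m nat_lt (fun p => (r (h p).1, r (h p).2)).
  by apply: grid_embedding_rank hemb _ => x y xh; apply/rC/List.in_or_app; left.
have [m' gm'] := bounded_on_grid m (fun p => (r (h p).1, r (h p).2)).
exact: Gb (Ginv _ _ _ _ GR remb gm').
Qed.

(** Although [G] is only maximal among coherent families, each property outside it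
    is contradicted by one of its members. The maximal family [D] of properties of
    arrays over [W * W] has this feature, and Erdos-Rado makes it symmetric enough
    to be compared with [G]. *)
Lemma coherent_maximal (G : set family_pair) k P :
  coherent G -> (forall G', coherent G' -> G `<=` G' -> G' = G) ->
  (exists b, forall m R, G (m, R) -> R b) ->
  on_grid k P -> ~ G (k, P) ->
  exists R, G (k, R) /\ forall c, R c -> ~ P c.
Proof.
move=> cohG Gmax Gb gP nGP.
have [W [lt [wo hom]]] :=
  erdos_rado (k + k * k) (((nat * nat -> Y) -> Prop) -> Prop) well_ordered_lex.
have [D [DP GD Dmax]] := maximal_definable_type (stretched_fin_sat wo cohG Gb).
have [|e0 [e0inc e0hom]] :=
    hom (fun w R => on_grid k R /\ D (pull (grid_of k w) R)).
  move=> w w' ww'; apply: funext => R; apply: propext.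
  suff H : on_grid k R -> pull (grid_of k w) R = pull (grid_of k w') R.
    by split=> -[gR]; [rewrite H|rewrite -H].
  move=> gR; apply: (on_grid_pull_eq gR) => -[s t] [/= sk tk].
  rewrite /grid_of /= !ww' // ?ltn_add2l ?ltn_addr //.
  apply: (@leq_trans (s.+1 * k)); rewrite ?leq_mul2r ?sk ?orbT //.
  by rewrite mulSn addnC ltn_add2r.
(* Row [s] is placed at [e0 (0, s)], and the elements [e0 (s.+1, t)] serve as the
   columns of row [s]. *)
pose est (p : nat * nat) := (e0 (0, p.1), e0 (p.1.+1, p.2)).
have est_emb m : grid_embedding m lt est.
  split=> [s s' t t' /andP[ss' _] _ _|//|s t t' _ /andP[tt' _]] /=; apply: e0inc.
    by right.
  by right.
(* The two copies of the grid are coded by increasing sequences along [e0], to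
   which [D] gives the same colour. *)
have est_hom R g : on_grid k R -> grid_embedding k nat_lt g ->
    D (pull est R) -> D (pull (est \o g) R).
  move=> gR gemb DR.
  have code h : grid_embedding k nat_lt h ->
      pull (grid_of k (e0 \o lex_code k h)) R = pull (est \o h) R.
    by move=> hemb; apply: (on_grid_pull_eq gR) => p pk; rewrite grid_of_lex_code.
  have := e0hom _ _ (lex_code_increasing (grid_embedding_id k))
    (lex_code_increasing gemb).
  move=> /(congr1 (fun T => T R)); rewrite !code //; last exact: grid_embedding_id.
  by move=> H; have : on_grid k R /\ D (pull (est \o id) R) by []; rewrite H => -[].
(* Closing under further transport of the grid makes [G'] coherent; its finite
   satisfiability comes from [D], read along [est]. *)
pose G' : set family_pair := fun q => G q \/ exists R g,
  [/\ on_grid k R, D (pull est R), grid_embedding k nat_lt g,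
      maps_grid k q.1 g & q.2 = pull g R].
have [Ggrid Ginv _] := cohG.
have G'D q : G' q -> D (pull est q.2).
  case: q => m Q [GQ|[R [g [gR DR gemb gkm /= ->]]]]; last first.
    exact: (est_hom R g gR gemb DR).
  by apply: GD; exists m, Q, est.
have GG' : G' = G.
  apply: Gmax; last by move=> q; left.
  split.
  - by move=> m Q [/Ggrid//|[R [g [gR _ gemb gkm /= ->]]]]; apply: on_grid_pull gkm.
  - move=> m m' Q h [GQ|[R [g [gR DR gemb gkm /= ->]]]] hemb hm.
      by left; apply: Ginv GQ hemb hm.
    right; exists R, (h \o g); split=> //=.
      exact: grid_embedding_comp gemb gkm hemb.
    by move=> p /gkm /hm.
  - move=> l lG'; have [|c Hc] := DP.2 (List.map (fun q => pull est q.2) l).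
      by move=> Q /List.in_map_iff[q [<- /lG'/G'D]].
    exists (c \o est) => q ql; apply: (Hc (pull est q.2)).
    by apply/List.in_map_iff; exists q.
have G_of_D R : on_grid k R -> D (pull est R) -> G (k, R).
  move=> gR DR; rewrite -GG'; right; exists R, id; split=> //.
  exact: grid_embedding_id.
have nDP : ~ D (pull est P) by move=> /(G_of_D P gP).
have [l [lD lP]] := maximal_inconsistent DP Dmax
  (definable_pullback est gP.1) nDP.
pose A w := exists p, in_grid k p /\ est p = w.
(* The conjunction of [l], as a condition on the image of the grid alone. *)
pose R0 (c : W * W -> Y) := exists c', (forall w, A w -> c' w = c w) /\
  forall Q, List.In Q l -> Q c'.
have dR0 : definable R0.
  by apply: definable_project; apply: definable_conj => Q /lD /DP.1.
have DR0 : D R0 by apply: (maximal_implied DP Dmax lD dR0) => c lc; exists c.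
have e0inj : injective e0.
  move=> p q epq; case: (wo_total well_ordered_lex p q) => [|[//|]] /e0inc;
  by rewrite epq => /(wo_irr wo).
have est_inj : injective est.
  by move=> [s t] [s' t'] [/e0inj[->] /e0inj[->]].
(* Pulling [R0] back along [h] turns it into a property of the grid itself. *)
have [h hP] : exists h, forall w, A w -> est (h w) = w.
  have [|h hP] := @choice (W * W) (nat * nat) (fun w p => A w -> est p = w).
    move=> w; have [[p [_ <-]]|nA] := pselect (A w); first by exists p.
    by exists (0, 0).
  by exists h.
have h_est p : in_grid k p -> h (est p) = p.
  by move=> pk; apply: est_inj; apply: hP; exists p.
have R0_local c c' : (forall w, A w -> c w = c' w) -> R0 c -> R0 c'.
  by move=> cc' [d [dc ld]]; exists d; split=> // w Aw; rewrite dc // cc'.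
exists (pull h R0); split.
  apply: G_of_D.
    split; first exact: definable_pullback.
    by move=> c c' cc'; apply: R0_local => w [p [pk <-]] /=; rewrite h_est // cc'.
  suff -> : pull est (pull h R0) = R0 by [].
  by apply: funext => c; apply: propext; split; apply: R0_local => w Aw /=; rewrite hP.
move=> d [c' [c'd lc']] Pd; apply: (lP c' lc'); rewrite /pull.
by apply: gP.2 Pd => p pk /=; rewrite c'd /= ?h_est //; exists p.
Qed.

End Modelling.

Local Close Scope classical_set_scope.

(** * Array modelling *)

Theorem theorem4p10 (S : Type) (L : language S) (T : theory L) (hT : JCP T)
    (K : Type) (U : structure L) (hU : is_monster T K U)
    (X : Type) (xs : X -> S) (hX : card_lt X K)
    (a : nat * nat -> stuple U xs)
    (E : pset U) (hE : card_lt (elt E) K) :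
  exists b : nat * nat -> stuple U xs,
    strongly_indiscernible E b /\ EM_ar_based E b a.
Proof.
(* The properties that hold at all the copies in [a] of a grid. *)
pose G0 : set (family_pair U xs) := fun q => on_grid E q.1 q.2 /\
  forall g, grid_embedding q.1 nat_lt g -> q.2 (a \o g).
have [G [cohG G0G Gmax]] : exists G, [/\ coherent E G, (G0 `<=` G)%classic &
    forall G', coherent E G' -> (G `<=` G')%classic -> G' = G].
  apply: maximal_coherent; split.
  - by move=> k P [].
  - move=> k m P g [gP aP] gemb gkm; split=> /=; first exact: on_grid_pull gkm.
    by move=> h hemb; apply: (aP (h \o g)); apply: grid_embedding_comp gemb gkm hemb.
  - move=> l lG; exists a => q ql; have [_ aq] := lG q ql.
    exact: (aq id (grid_embedding_id _)).
have [Ggrid Ginv Gfs] := cohG.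
have [b bG] : exists b : nat * nat -> stuple U xs, forall k P, G (k, P) -> P b.
  have [||l lG|b bG] := @definable_realised S L U E X xs K _
      (fun P => exists k, G (k, P)) (monster_saturated hU) hE.
  - exact: grid_prod_card_lt (monster_nat hU) hX.
  - by move=> P [k GP]; have [] := Ggrid k P GP.
  - have [f fP] : exists f : ((nat * nat -> stuple U xs) -> Prop) -> nat,
        forall P, List.In P l -> G (f P, P).
      have [|f fP] := @choice _ nat (fun P k => List.In P l -> G (k, P)).
        move=> P; have [Pl|nPl] := pselect (List.In P l); last by exists 0.
        by have [k GP] := lG P Pl; exists k.
      by exists f.
    have [|c cl] := Gfs (List.map (fun P => (f P, P)) l).
      by move=> q /List.in_map_iff[P [<- Pl]]; apply: fP.
    exists c => P Pl; apply: (cl (f P, P)).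
    by apply/List.in_map_iff; exists P.
  - by exists b => k P GP; apply: bG; exists k.
have b_emb k P g : G (k, P) -> grid_embedding k nat_lt g -> P (b \o g).
  move=> GP gemb; have [m gkm] := bounded_on_grid k g.
  exact: bG (Ginv _ _ _ _ GP gemb gkm).
(* A property satisfied at one copy of the grid in [b] cannot be contradicted by a
   member of [G], since the latter holds at all copies. *)
have G_of k P g : on_grid E k P -> grid_embedding k nat_lt g -> P (b \o g) ->
    G (k, P).
  move=> gP gemb bP; apply: contrapT => nGP.
  have [R [GR RP]] := coherent_maximal cohG Gmax (ex_intro _ b bG) gP nGP.
  exact: RP (b_emb _ _ _ GR gemb) bP.
pose on_block n (eta : 'I_n -> nat * nat) (phi : formula_over E (@block_sort _ _ xs n)) :=
  fun c => sat_over phi (block c eta).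
have on_block_grid n (eta : 'I_n -> nat * nat) phi :
    exists k, on_grid E k (on_block n eta phi) /\ forall i, in_grid k (eta i).
  pose k := (\max_i maxn (eta i).1 (eta i).2).+1.
  have etak i : in_grid k (eta i).
    have := leq_bigmax (F := fun i => maxn (eta i).1 (eta i).2) i.
    by rewrite geq_max => /andP[].
  exists k; split=> //; split.
    apply: (definable_pullback (P := fun c => sat_over phi (flatten_family c)) eta).
    by exists phi.
  move=> c c' cc'; rewrite /on_block.
  suff -> : block c eta = block c' eta by [].
  by apply: functional_extensionality_dep => w; rewrite /block cc'.
exists b; split; last first.
  move=> n eta phi EMphi xi etaxi; have [k [gphi xik]] := on_block_grid n xi phi.
  apply: (bG k (on_block n xi phi)); apply: G0G; split=> //= g gemb.
  apply: (EMphi (g \o xi)); apply: same_qftp_trans etaxi _.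
  exact: same_qftp_grid gemb xik.
move=> n eta phi; split=> [|phi_eta xi etaxi]; first by apply.
(* The formula passes from [eta] to its image under [f], which is the image of [xi]
   under [g], and from there back to [xi]. *)
have [f [g [femb gemb fg]]] := same_qftp_amalgam etaxi.
have [k [gphi _]] := on_block_grid n eta phi.
have [m [gphi' _]] := on_block_grid n xi phi.
apply: (bG m (on_block n xi phi)); apply: (G_of _ _ g) => //.
have := b_emb _ _ f (G_of _ _ id gphi (grid_embedding_id k) phi_eta) (femb k).
have blockE h theta : on_block n theta phi (b \o h) =
    sat_over phi (block b (h \o theta)) by [].
by rewrite !blockE fg.
Qed.
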